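(* Let $\mathfrak{B}$ be a bornology with a compact base $\mathfrak{B}_0$ on a topological space $X$. Let $X$ be $\mathfrak{B}$-Lindelöf and satisfy $CDR_{sub}(\mathcal{O}_{\mathfrak{B}},\mathcal{O}_{\mathfrak{B}})$. If $X$ satisfies $S_{fin}(\mathcal{O}_{\mathfrak{B}},\mathcal{O}^{gp}_{\mathfrak{B}})$, then $X^n$ satisfies $U_{fin}(\mathcal{O}_{\mathfrak{B}^n},\Gamma_{\mathfrak{B}^n})$ for every integer $n\ge 1$.
   Context: A bornology $\mathfrak{B}$ on a space $X$ is a family of subsets of $X$ that is closed under taking subsets and finite unions and covers $X$; by standing convention $X\notin\mathfrak{B}$. A base of $\mathfrak{B}$ is a subfamily $\mathfrak{B}_0\subseteq\mathfrak{B}$ such that every $B\in\mathfrak{B}$ is contained in some $B_0\in\mathfrak{B}_0$; it is compact if its members are compact subsets of $X$. $\mathfrak{B}^n$ denotes the bornology on $X^n$ generated by $\{B^n:B\in\mathfrak{B}\}$. For a bornology $\mathfrak{C}$ on a space $Y$: $\mathcal{O}_{\mathfrak{C}}$ is the collection of all open $\mathfrak{C}$-covers of $Y$, i.e. families $\mathcal{U}$ of open subsets of $Y$ with $Y\notin\mathcal{U}$ such that every $C\in\mathfrak{C}$ is contained in some $U\in\mathcal{U}$; $Y$ is $\mathfrak{C}$-Lindelöf if every open $\mathfrak{C}$-cover contains a countable subfamily that is a $\mathfrak{C}$-cover; $\Gamma_{\mathfrak{C}}$ is the collection of all $\gamma_{\mathfrak{C}}$-covers of $Y$, i.e. infinite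 covers $\{U_k:k\in\omega\}$ of $Y$ by proper open subsets such that for each $C\in\mathfrak{C}$ there is $k_0$ with $C\subseteq U_k$ for all $k\ge k_0$; an open cover $\mathcal{U}$ of $Y$ is $\mathfrak{C}$-groupable if $\mathcal{U}=\bigcup_{k\in\omega}\mathcal{U}_k$ with the $\mathcal{U}_k$ pairwise disjoint finite subsets of $\mathcal{U}$ such that for every $C\in\mathfrak{C}$ there is $k_0$ such that for all $k\ge k_0$, $C\subseteq U$ for some $U\in\mathcal{U}_k$; $\mathcal{O}^{gp}_{\mathfrak{C}}$ is the collection of all open $\mathfrak{C}$-groupable covers. For collections $\mathcal{A},\mathcal{B}$ of families of subsets of a space $Y$ and every sequence $\{\mathcal{U}_k:k\in\omega\}$ of elements of $\mathcal{A}$: $S_{fin}(\mathcal{A},\mathcal{B})$ requires finite (possibly empty) $\mathcal{V}_k\subseteq\mathcal{U}_k$ with $\bigcup_{k\in\omega}\mathcal{V}_k\in\mathcal{B}$; $U_{fin}(\mathcal{A},\mathcal{B})$ requires finite (possibly empty) $\mathcal{V}_k\subseteq\mathcal{U}_k$ such that $\{\bigcup\mathcal{V}_k:k\in\omega\}\in\mathcal{B}$ or $\bigcup\mathcal{V}_k=Y$ for some $k$; $CDR_{sub}(\mathcal{A},\mathcal{B})$ requires $\mathcal{V}_k\subseteq\mathcal{U}_k$ ($k\in\omega$), pairwise disjoint, with each $\mathcal{V}_k\in\mathcal{B}$. *)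

(* Defs.v *)
From mathcomp Require Import all_boot.
From mathcomp Require Import all_classical topology.

Set Implicit Arguments.
Unset Strict Implicit.
Unset Printing Implicit Defensive.

Local Open Scope classical_set_scope.

Section Bornology.
Context {T : Type}.
Implicit Types (B : set (set T)).

(* Closure under binary unions is closure under nonempty finite unions; when T
   is inhabited the empty set belongs to B by the covering and subset clauses. *)
Definition bornology B : Prop :=
  [/\ (forall A A' : set T, A `<=` A' -> B A' -> B A),
      setU_closed B,
      \bigcup_(A in B) A = [set: T] &
      ~ B [set: T]].

Definition bornology_base B (B0 : set (set T)) : Prop :=
  B0 `<=` B /\ forall A, B A -> exists2 A0, B0 A0 & A `<=` A0.

End Bornology.

Section BornologicalCovers.
Context {Y : topologicalType}.
Implicit Types (C : set (set Y)) (U : set (set Y)).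

Definition bornological_cover C U : Prop :=
  ~ U [set: Y] /\ forall A, C A -> exists2 W, U W & A `<=` W.

Definition open_covers C : set (set (set Y)) :=
  [set U | U `<=` open /\ bornological_cover C U].

Definition bornological_lindelof C : Prop :=
  forall U, open_covers C U ->
    exists V, [/\ V `<=` U, countable V & bornological_cover C V].

Definition gamma_covers C : set (set (set Y)) :=
  [set G | exists W : nat -> set Y,
    [/\ G = range W,
        infinite_set G,
        \bigcup_(A in G) A = [set: Y],
        (forall k, open (W k) /\ W k <> [set: Y]) &
        forall A, C A ->
          exists k0, forall k, (k0 <= k)%N -> A `<=` W k]].

Definition groupable C U : Prop :=
  exists G : nat -> set (set Y),
    [/\ U = \bigcup_k G k,
        (forall k, finite_set (G k)),
        trivIset setT G &
        forall A, C A ->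
          exists k0, forall k, (k0 <= k)%N -> exists2 W, G k W & A `<=` W].

Definition open_groupable_covers C : set (set (set Y)) :=
  [set U | [/\ U `<=` open, \bigcup_(W in U) W = [set: Y] & groupable C U]].

End BornologicalCovers.

Section SelectionPrinciples.
Context {Y : Type}.
Implicit Types (A B : set (set (set Y))).

Definition S_fin A B : Prop :=
  forall U : nat -> set (set Y), (forall k, A (U k)) ->
    exists V : nat -> set (set Y),
      (forall k, V k `<=` U k /\ finite_set (V k)) /\ B (\bigcup_k V k).

(* The selected unions are tested as a family of sets, not as a sequence. *)
Definition U_fin A B : Prop :=
  forall U : nat -> set (set Y), (forall k, A (U k)) ->
    exists V : nat -> set (set Y),
      (forall k, V k `<=` U k /\ finite_set (V k)) /\
      (B (range (fun k => \bigcup_(W in V k) W)) \/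
       exists k, \bigcup_(W in V k) W = [set: Y]).

Definition CDR_sub A B : Prop :=
  forall U : nat -> set (set Y), (forall k, A (U k)) ->
    exists V : nat -> set (set Y),
      [/\ (forall k, V k `<=` U k), trivIset setT V & forall k, B (V k)].

End SelectionPrinciples.

(* X^n with the product topology. *)
Definition power_space (X : topologicalType) (n : nat) : topologicalType :=
  {ptws 'I_n -> X}.

Definition set_power (X : topologicalType) (n : nat) (A : set X) :
    set (power_space X n) :=
  [set x | forall i : 'I_n, A (x i)].
Arguments set_power {X} n A.

Definition power_bornology (X : topologicalType) (n : nat) (B : set (set X)) :
    set (set (power_space X n)) :=
  smallest bornology [set set_power n A | A in B].
Arguments power_bornology {X} n B.

(* Main.v *)
Require Import Defs.
From mathcomp Require Import all_boot.
From mathcomp Require Import all_classical topology.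

Local Open Scope classical_set_scope.

(** The argument transports the covers of X^n down to X, applies the selection
    principle there once, and reads the groups it produces as a sequence.

    Write U_0, U_1, ... for the given open covers of X^n.  If K is compact and
    K^n lies in an open set D, then K^n has a neighbourhood of the form W^n
    inside D ([set_power_tube]).  Hence the open sets W whose power W^n is
    contained in a member of each of U_0, ..., U_k form an open B-cover R_k of
    X ([open_covers_power_refinement]), and these covers decrease with k.

    Applying S_fin to (R_k) gives finite V_k in R_k and a partition of the union
    of the V_k into finite groups such that every member of B lies in some
    element of all but finitely many groups.  The groups are disjoint, so
    only finitely many of them meet the finite union of V_0, ..., V_(k-1); any
    later group consists of elements of V_j with j >= k, hence of elements of R_k.
    Assigning such a group to each k yields finite F_k in R_k which eventually
    catch every member of B ([S_fin_groupable_select]).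

    Replacing each W in F_k by a member of U_k containing W^n gives a finite
    part of U_k; its union S_k is such that each A^n with A in B is contained
    in S_k for k large.  What separates this from a gamma-cover is that the
    family of all S_k must be infinite with proper members.  If all S_k are proper and
    only finitely many distinct sets occur, pick a point outside each of them;
    a late S_k contains all of these points, a contradiction
    ([gamma_cover_or_full]).  So either some S_k is X^n or the family is a
    gamma-cover. *)

(** The box filter at [x] converges to [x] in each coordinate, hence in the
    product topology, so every neighbourhood of [x] contains a box. *)
Lemma ptws_nbhs_box {I : Type} {X : topologicalType}
    {x : {ptws I -> X}} {U : set {ptws I -> X}} : nbhs x U ->
  exists2 O : I -> set X, (forall i, nbhs (x i) (O i)) &
    forall z : I -> X, (forall i, O i (z i)) -> U z.
Proof.
pose F := filter_from [set O : I -> set X | forall i, nbhs (x i) (O i)]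
  (fun O => [set z : {ptws I -> X} | forall i, O i (z i)]).
have FF : Filter F.
  apply: filter_from_filter; first by exists (fun=> setT) => i; exact: filterT.
  move=> P Q xP xQ; exists (fun i => P i `&` Q i).
    by move=> i; exact: filterI.
  by move=> z PQz; split=> i; have [] := PQz i.
suff Fx : F --> x by move=> /Fx[O xO sOU]; exists O.
apply/cvg_sup => i A; rewrite nbhsE => -[_ [[N oN <-] Nx] sNA].
exists (fun j => [set y | j = i -> N y]) => [j /=|z Oz].
  have [->|ji] := pselect (j = i); last by apply: filterE => y /= /ji.
  by apply: filterS (open_nbhs_nbhs (conj oN Nx)) => y Ny _.
by apply: sNA; exact: (Oz i).
Qed.

(** The tube lemma with the same factor in every coordinate.  Compactness of
    K^n is used in its near-covering form, with functions choosing a set around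
    each point of X as parameters that shrink: for one such choice N of
    neighbourhoods, every box with sides N (y i), y in K^n, lies in U.
    The union of the N y over y in K is then the required set, since a point of
    its power has each coordinate in some N (y i) with y i in K. *)
Lemma set_power_tube {X : topologicalType} {n : nat} {K : set X}
    {U : set (power_space X n)} :
  compact K -> open U -> set_power n K `<=` U ->
  exists W, [/\ open W, K `<=` W & set_power n W `<=` U].
Proof.
move=> cK oU sKU.
pose F := filter_from [set N : X -> set X | forall y, nbhs y (N y)]
  (fun N => [set c : X -> set X | forall y, c y `<=` N y]).
have FF : Filter F.
  apply: filter_from_filter; first by exists (fun=> setT) => y; exact: filterT.
  move=> N N' nN nN'; exists (fun y => N y `&` N' y).
    by move=> y; apply: filterI; [exact: nN|exact: nN'].
  by move=> c cNN'; split=> y z /cNN'[].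
pose P c (x : power_space X n) :=
  forall z : power_space X n, (forall i, c (x i) (z i)) -> U z.
have /compact_near_coveringP cKn : compact (set_power n K).
  exact: (@tychonoff _ (fun=> X) (fun=> K)).
have [|N nN NP] := cKn _ F P FF.
  move=> x /sKU Ux.
  have [O xO sOU] := ptws_nbhs_box (open_nbhs_nbhs (conj oU Ux)).
  (* A single N y has to serve whichever coordinates take the value y, hence
     the intersection over all i whose O i surrounds y. *)
  pose N y := [set z | forall i, (O i)^° y -> O i z].
  have nN y : nbhs y (N y).
    by apply: filter_forall => i; apply: filter_imply.
  exists ([set x' : power_space X n | forall i, (O i)^° (x' i)],
          [set c : X -> set X | forall y, c y `<=` N y]) => /=.
    split; last by exists N.
    apply: (filter_forall (nbhs_filter x)) => i.
    apply: (@proj_continuous _ (fun=> X) i x (O i)^°).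
    exact: nbhs_interior (xO i).
  move=> [x' c] [/= Ox' cN] z cz.
  by apply: sOU => i; exact: (cN _ _ (cz i) i (Ox' i)).
exists (\bigcup_(y in K) N y)^°; split; first exact: open_interior.
  by move=> y Ky; apply: filterS (nN y) => z Nz; exists y.
move=> z Wz.
have /choice[y Hy] i : exists y, K y /\ N y (z i).
  by have [y Ky Ny] := interior_subset (Wz i); exists y.
apply: (NP N _ y) => [y' //|i|i]; by case: (Hy i).
Qed.

(** For n = 0 the space X^n is a point and lies in every A^n, so no bornology
    contains the powers of a nonempty family B, and the smallest one
    degenerates; this is where n >= 1 is needed. *)
Lemma power_bornologyP {X : topologicalType} {B : set (set X)} {n : nat} :
  bornology B -> (0 < n)%N ->
  bornology (power_bornology n B) /\
  power_bornology n B = [set D | exists2 A, B A & D `<=` set_power n A].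
Proof.
case: n => // n [subB BU covB properB] _.
pose P := [set D | exists2 A, B A & D `<=` set_power n.+1 A].
have bornP : bornology P.
  split=> [A A' AA' [C BC A'C]|D D' [A BA DA] [A' BA' DA']||[A BA XA]].
  - by exists C => //; exact: subset_trans A'C.
  - exists (A `|` A'); first exact: BU.
    by move=> z [/DA Az|/DA' Az] i; [left|right]; exact: Az.
  - rewrite -subTset => z _.
    have /choice[A HA] i : exists A, B A /\ A (z i).
      by have : [set: X] (z i) by []; rewrite -covB => -[A]; exists A.
    (* n + 1 > 0 supplies a coordinate, hence a member of B to shrink. *)
    have B0 : B set0 by case: (HA ord0) => BA _; exact: subB BA.
    have BA : B (\big[setU/set0]_(i < n.+1) A i).
      by apply: big_ind => [//|//|i _]; case: (HA i).
    exists (set_power n.+1 (\big[setU/set0]_(i < n.+1) A i)).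
      by exists (\big[setU/set0]_(i < n.+1) A i).
    move=> i; rewrite -bigcup_mkord_ord; exists i => //=.
    by rewrite inord_val; case: (HA i).
  - apply: properB; suff <- : A = [set: X] by [].
    by rewrite -subTset => y _; apply: (XA (fun=> y) I ord0).
have -> : power_bornology n.+1 B = P; last by [].
rewrite eqEsubset; split.
  by apply: smallest_sub => // _ [A BA <-]; exists A.
move=> D [A BA DA] M [[subM _ _ _] genM]; apply: subM DA _.
by apply: genM; exists A.
Qed.

Lemma near_finite_forall {S T : Type} {E : set T} (Q : S -> T -> Prop)
    (F : set_system S) {FF : Filter F} :
  finite_set E -> (forall W, E W -> \forall k \near F, Q k W) ->
  \forall k \near F, forall W, E W -> Q k W.
Proof.
case/finite_setP => m; elim: m E => [|m IH] E.
  by rewrite II0 card_eq0 => /eqP-> _; apply: filterE => k W.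
move=> /eq_cardSP[W EW Em] EQ.
have QE' : \forall k \near F, forall W', (E `\ W) W' -> Q k W'.
  by apply: IH => // W' [EW' _]; exact: EQ.
apply: filterS2 (EQ _ EW) QE' => k QW QE W' EW'.
by have [->//|W'W] := pselect (W' = W); apply: QE.
Qed.

(** Groups need not follow the order in which their elements were selected.
    Disjointness repairs this: finitely many selected sets meet finitely many
    groups, so a late group only contains late selections, and these refine all
    earlier covers because R decreases. *)
Lemma S_fin_groupable_select {X : topologicalType} {B : set (set X)}
    {R : nat -> set (set X)} :
  S_fin (open_covers B) (open_groupable_covers B) ->
  (forall k, open_covers B (R k)) -> (forall j k, (j <= k)%N -> R k `<=` R j) ->
  exists F : nat -> set (set X),
    (forall k, F k `<=` R k /\ finite_set (F k)) /\
    forall A, B A -> \forall k \near \oo, exists2 W, F k W & A `<=` W.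
Proof.
move=> sel coverR decR.
have [V [VR [_ _ [G [VG finG trivG BG]]]]] := sel R coverR.
have /choice[m Hm] k : exists m, (k <= m)%N /\
    forall W, (\bigcup_(j in `I_k) V j) W -> ~ G m W.
  have finV : finite_set (\bigcup_(j in `I_k) V j).
    by apply: bigcup_finite => // j _; case: (VR j).
  have avoid : \forall m \near \oo, forall W,
      (\bigcup_(j in `I_k) V j) W -> ~ G m W.
    apply: near_finite_forall => // W _.
    have [[m0 Gm0]|noG] := pselect (exists m0, G m0 W); last first.
      by apply: filterE => m Gm; apply: noG; exists m.
    exists m0.+1 => // m /= m0m Gm.
    have mm0 : m0 = m by apply: trivG => //; exists W.
    by move: m0m; rewrite mm0 ltnn.
  have [m [km Gm]] := filter_ex (filterI (nbhs_infty_ge k) avoid).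
  by exists m.
exists (fun k => G (m k)); split=> [k|A /BG[k0 Gk0]].
  split=> // W GW; have [km avoid] := Hm k.
  have : (\bigcup_j G j) W by exists (m k).
  rewrite -VG => -[j _ Vj].
  apply: (decR k j); last by case: (VR j) => sV _; exact: sV.
  by rewrite leqNgt; apply/negP => jk; apply: avoid GW; exists j.
exists k0 => // k /= k0k; apply: Gk0; apply: leq_trans k0k _.
by case: (Hm k).
Qed.

(** A gamma-cover is an infinite family, whereas a sequence may repeat itself.
    Repetition does no harm: a sequence with finite range in which every point
    eventually stays takes the value of the whole space. *)
Lemma gamma_cover_or_full {Y : topologicalType} {C : set (set Y)}
    {S : nat -> set Y} :
  bornology C -> (forall k, open (S k)) ->
  (forall A, C A -> \forall k \near \oo, A `<=` S k) ->
  gamma_covers C (range S) \/ exists k, S k = [set: Y].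
Proof.
move=> [subC _ covC _] oS CS.
have [|noFull] := pselect (exists k, S k = [set: Y]); first by right.
have pt (y : Y) : \forall k \near \oo, S k y.
  have : [set: Y] y by [].
  by rewrite -covC => -[A CA Ay]; apply: filterS (CS A CA) => k; apply.
left; exists S; split=> //.
- move=> finS.
  have avoid : \forall k \near \oo, forall W, range S W -> S k <> W.
    apply: (near_finite_forall (fun k W => S k <> W)) => // _ [j _ <-].
    have /existsNP[y Sjy] : ~ forall y, S j y.
      by move=> Sj; apply: noFull; exists j; rewrite -subTset => y _.
    by apply: filterS (pt y) => k + SkSj; rewrite SkSj.
  by have [k /(_ (S k))] := filter_ex avoid; apply => //; exists k.
- rewrite -subTset => y _; have [k Sky] := filter_ex (pt y).
  by exists (S k) => //; exists k.
- by move=> k; split=> // Sk; apply: noFull; exists k.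
- by move=> A /CS[k0 _ Sk0]; exists k0 => k /Sk0.
Qed.

(** Asking for all j <= k rather than j = k makes the families decrease, as
    [S_fin_groupable_select] requires. *)
Definition power_refinement {X : topologicalType} {n : nat}
    (U : nat -> set (set (power_space X n))) (k : nat) : set (set X) :=
  [set W | open W /\
    forall j, (j <= k)%N -> exists2 D, U j D & set_power n W `<=` D].

Lemma open_covers_power_refinement {X : topologicalType} {B B0 : set (set X)}
    {n : nat} {U : nat -> set (set (power_space X n))} :
  bornology_base B B0 -> (forall K, B0 K -> compact K) ->
  (forall k, open_covers (power_bornology n B) (U k)) ->
  forall k, open_covers B (power_refinement U k).
Proof.
move=> [subB baseB] cptB0 coverU k; split; first by move=> W [].
split=> [[_ /(_ 0 (leq0n k))[D UD]]|A BA].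
  have -> : set_power n [set: X] = setT by rewrite -subTset => z _ i.
  rewrite subTset => DT; move: UD; rewrite DT.
  by have [_ []] := coverU 0.
have [K B0K AK] := baseB A BA; have cK := cptB0 K B0K.
suff [W [KW [oW WU]]] : exists W, K `<=` W /\ power_refinement U k W.
  by exists W => //; exact: subset_trans KW.
have tube j : exists W, [/\ open W, K `<=` W &
    exists2 D, U j D & set_power n W `<=` D].
  have [oU [_ /(_ (set_power n K))[]]] := coverU j.
    by apply: sub_gen_smallest; exists K => //; exact: subB.
  move=> D UD KD; have [W [oW KW WD]] := set_power_tube cK (oU _ UD) KD.
  by exists W; split=> //; exists D.
have shrink (W W' : set X) : W `<=` W' -> set_power n W `<=` set_power n W'.
  by move=> WW' z Wz i; exact/WW'/Wz.
elim: k => [|k [W [KW [oW WU]]]].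
  have [W [oW KW WD]] := tube 0; exists W; split=> //; split=> // j.
  by rewrite leqn0 => /eqP->.
have [W' [oW' KW' [D' UD' WD']]] := tube k.+1.
exists (W `&` W'); split; first by move=> y Ky; split; [exact: KW|exact: KW'].
split=> [|j]; first exact: openI.
rewrite leq_eqVlt => /orP[/eqP->|jk].
  by exists D' => //; apply: subset_trans WD'; apply: shrink => y [].
have [D UD WD] := WU j jk.
by exists D => //; apply: subset_trans WD; apply: shrink => y [].
Qed.

Theorem theorem4p6 (X : topologicalType) (B B0 : set (set X))
    (hB : bornology B) (hB0 : bornology_base B B0)
    (hcompact : forall K : set X, B0 K -> compact K)
    (hLindelof : bornological_lindelof B)
    (hCDR : CDR_sub (open_covers B) (open_covers B))
    (hSfin : S_fin (open_covers B) (open_groupable_covers B)) :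
  forall n : nat, (1 <= n)%N ->
    U_fin (open_covers (power_bornology n B))
          (gamma_covers (power_bornology n B)).
Proof.
move=> n n0 U coverU; have [bornP powE] := power_bornologyP hB n0.
(* The last argument is the monotonicity of [power_refinement U]. *)
have [F [FR BF]] := S_fin_groupable_select hSfin
  (open_covers_power_refinement hB0 hcompact coverU)
  (fun j k jk W '(conj oW WU) => conj oW (fun i ij => WU i (leq_trans ij jk))).
have /choice[D HD] (kW : nat * set X) : exists D, F kW.1 kW.2 ->
    U kW.1 D /\ set_power n kW.2 `<=` D.
  have [/(proj1 (FR kW.1))[_ /(_ _ (leqnn _))[D UD WD]]|] :=
    pselect (F kW.1 kW.2); last by exists set0.
  by exists D.
exists (fun k => [set D (k, W) | W in F k]); split=> [k|].
  split; last by apply: finite_image; case: (FR k).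
  by move=> _ [W FW <-]; case: (HD (k, W) FW).
apply: gamma_cover_or_full => // [k|E].
  apply: bigcup_open => _ [W FW <-]; have [oU _] := coverU k.
  by apply: oU; case: (HD (k, W) FW).
rewrite powE => -[A /BF AF EA]; apply: filterS AF => k [W FW AW] z /EA Az.
have [_ WD] := HD (k, W) FW.
exists (D (k, W)); first by exists W.
by apply: WD => i; exact/AW/Az.
Qed.
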